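(* Let $p$ be a prime, let $n\ge 3$, let $l,c$ be positive integers with $l+c<n$, and let $r,s$ be powers of $p$ with non-negative integer exponents such that $r>1$ or $s>1$. The polynomial $N_l^c(x,y)\in\mathbb{Z}[x,y]$ is monic of degree $(l+c)(n-l-c)$ with respect to the variable $y$, and, for every integer $\nu\ge 1$, the number of $\mathbb{F}_{(rs)^\nu}$-rational points of the Frobenius incidence variety $X=X[r,s]_l^c$ is equal to $N_l^c(rs,(rs)^\nu)$.
   Context: **The polynomials.** For integers $0\le k\le m$ put $$g_{m,k}(x)=g_m^{m-k}(x):=\frac{\prod_{i=0}^{k-1}(x^m-x^i)}{\prod_{i=0}^{k-1}(x^k-x^i)}\in\mathbb{Z}[x],$$ and $g_{m,k}(x)=g_m^{m-k}(x):=0$ if $k<0$ or $k>m$ (so $g_m^c=g_{m,m-c}$). Order pairs of non-negative integers lexicographically: $(l,d)\succ(l',d')$ iff $l>l'$, or $l=l'$ and $d>d'$. With $n$ fixed, define $\tau_{l,d}(x,y)\in\mathbb{Z}[x,y]$ for non-negative integers $l,d$ by descending induction with respect to $\succ$: $\tau_{l,d}=0$ if $l>n$ or $d>l$; $\tau_{l,l}=g_{n,l}(x)$ if $d=l\le n$; and for $d<l\le n$ $$\tau_{l,d}(x,y):=\sum_{u=l}^{2l-d}\tau_{2l-d,u}(x,y)\,g_{u,l}(y)-\sum_{t=d+1}^{l}\tau_{l,t}(x,y)\,g_{n-2l+t,\,t-d}(y).$$ For positive integers $l,c$ with $l+c<n$ put $$N_l^c(x,y):=\sum_{d=0}^{l}\tau_{l,d}(x,y)\,g_{n-2l+d}^c(y).$$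 **The variety.** Fix an $n$-dimensional vector space $V$ over $\mathbb{F}_p$. $G_{n,l}=G_n^{n-l}$ is the Grassmannian of $l$-dimensional subspaces of $V$ (so $G_n^c$ parametrizes subspaces of codimension $c$). Let $\mathcal{I}\subset G_{n,l}\times G_n^c$ be the reduced incidence subvariety $\{(L,M): L\subset M\}$. For a power $q=p^\nu$ with $\nu\ge1$, $\phi^{(q)}$ is the $q$-th power Frobenius morphism of a Grassmannian, $\phi^{(1)}=\mathrm{id}$, and $L^q$ is the image of $L$ under $\phi^{(q)}$ (raise the coefficients of defining linear equations of $L$ to the $q$-th power). Then $X[r,s]_l^c:=(\phi^{(r)}\times\mathrm{id})^*\mathcal{I}\cap(\mathrm{id}\times\phi^{(s)})^*\mathcal{I}\subset G_{n,l}\times G_n^c$ (scheme-theoretic intersection, over $\mathbb{F}_p$); for any field $F\supset\mathbb{F}_p$, $X(F)=\{(L,M)\in G_{n,l}(F)\times G_n^c(F): L^r\subset M,\ L\subset M^s\}$. *)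

(* Defs.v *)
From HB Require Import structures.
From mathcomp Require Import all_boot all_order all_algebra all_field zify.

Set Implicit Arguments.
Unset Strict Implicit.
Unset Printing Implicit Defensive.

Import Order.TTheory GRing.Theory Num.Theory.
Local Open Scope ring_scope.

(* Z[x,y] is {poly {poly int}}: the outer variable is y and the coefficients
   are polynomials in x. *)
Definition eval_xy (P : {poly {poly int}}) (x y : int) : int := P.[y%:P].[x].

(* g_{m,k}.  The indices are integers, since n - 2l + t below can be negative.
   The denominator is monic, so %/ is Euclidean division in Z[x]. *)
Definition g (m k : int) : {poly int} :=
  if 0 <= k <= m then
    (\prod_(i < `|k|%N) ('X^`|m|%N - 'X^i))
      %/ (\prod_(i < `|k|%N) ('X^`|k|%N - 'X^i))
  else 0.

(* g_m^c *)
Definition g_codim (m c : int) : {poly int} := g m (m - c).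

Definition in_x (f : {poly int}) : {poly {poly int}} := f%:P.
Definition in_y (f : {poly int}) : {poly {poly int}} := map_poly polyC f.

(* The fuel only makes the recursion structural: see [tauE]. *)
Fixpoint tau_rec (n fuel l d : nat) : {poly {poly int}} :=
  if fuel is f.+1 then
    if (n < l)%N || (l < d)%N then 0
    else if d == l then in_x (g n l)
    else \sum_(l <= u < (2 * l - d)%N.+1)
           tau_rec n f (2 * l - d)%N u * in_y (g u l)
       - \sum_(d.+1 <= t < l.+1)
           tau_rec n f l t * in_y (g (n%:Z - 2 * l%:Z + t%:Z) (t%:Z - d%:Z))
  else 0.

Definition tau (n l d : nat) : {poly {poly int}} :=
  tau_rec n (n.+1 * n.+1)%N l d.

Lemma tau_rec_fuel n f f' l d :
  ((n - l) * n.+1 + (l - d) < f)%N -> ((n - l) * n.+1 + (l - d) < f')%N ->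
  tau_rec n f l d = tau_rec n f' l d.
Proof.
elim: f f' l d => [|f IH] [|f'] l d //= lt_f lt_f'.
case: ifP => // /negbT; rewrite negb_or -!leqNgt => /andP[le_ln le_dl].
case: eqVneq => // ne_dl; have lt_dl : (d < l)%N by rewrite ltn_neqAle ne_dl.
congr (_ - _).
  apply: eq_big_nat => u /andP[le_lu _]; congr (_ * _).
  case: (leqP (2 * l - d) n) => [le_n|gt_n]; last first.
    by case: {+}f => [|f0]; case: {+}f' => [|f0'] //=; rewrite gt_n.
  by apply: IH; nia.
by apply: eq_big_nat => t /andP[lt_dt _]; congr (_ * _); apply: IH; nia.
Qed.

Lemma tauE n l d :
  tau n l d =
    if (n < l)%N || (l < d)%N then 0
    else if d == l then in_x (g n l)
    else \sum_(l <= u < (2 * l - d)%N.+1) tau n (2 * l - d)%N u * in_y (g u l)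
       - \sum_(d.+1 <= t < l.+1)
           tau n l t * in_y (g (n%:Z - 2 * l%:Z + t%:Z) (t%:Z - d%:Z)).
Proof.
case: (leqP l n) => [le_ln|gt_ln]; last by rewrite /tau /= gt_ln.
have fuel : ((n - l) * n.+1 + (l - d) < n.+1 * n.+1)%N by nia.
rewrite {1}/tau (tau_rec_fuel fuel (leqW fuel)).
by rewrite -(leq_gtF le_ln).
Qed.

(* N_l^c *)
Definition N (n l c : nat) : {poly {poly int}} :=
  \sum_(0 <= d < l.+1)
    tau n l d * in_y (g_codim (n%:Z - 2 * l%:Z + d%:Z) c%:Z).

Section FiniteSpaces.

Import VectorInternalTheory.
Variables (F : finFieldType) (vT : vectType F).

HB.instance Definition _ := [Countable of {vspace vT} by <:].
HB.instance Definition _ := [Finite of {vspace vT} by <:].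

End FiniteSpaces.

Section Variety.

(* V is identified with the coordinate space F_p^n; its base change to the
   finite field F is 'rV[F]_n. *)
Variables (F : finFieldType) (n : nat).
Local Notation V := 'rV[F]_n.

(* G_{n,l}(F) *)
Definition grass (l : nat) : {set {vspace V}} := [set L | \dim L == l].

(* G_n^c(F) *)
Definition grass_codim (c : nat) : {set {vspace V}} :=
  [set M : {vspace V} | (\dim M + c)%N == n].

(* The zeros of the linear form with coefficient vector a. *)
Definition zeros (a : 'cV[F]_n) : {vspace V} := lker (linfun (mulmxr a)).

(* L^q: raise to the q-th power the coefficients of every linear equation
   satisfied on L. *)
Definition frob (q : nat) (L : {vspace V}) : {vspace V} :=
  (\bigcap_(a : 'cV[F]_n | (L <= zeros a)%VS)
     zeros (map_mx (fun t => t ^+ q)%R a))%VS.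

(* The F-points of X[r,s]_l^c. *)
Definition frob_incidence (r s l c : nat) : {set {vspace V} * {vspace V}} :=
  [set LM in setX (grass l) (grass_codim c) |
     (frob r LM.1 <= LM.2)%VS && (LM.1 <= frob s LM.2)%VS].

End Variety.

(* Main.v *)
From HB Require Import structures.
Require Import Defs.
From mathcomp Require Import all_boot all_order all_algebra.
From mathcomp Require Import all_fingroup all_solvable all_field zify ring.

Set Implicit Arguments.
Unset Strict Implicit.
Unset Printing Implicit Defensive.

Import Order.TTheory GRing.Theory Num.Theory.
Local Open Scope ring_scope.

(** Put Q = rs and y = |F| = Q^nu, and let phi = [frob Q] act on the subspaces
    of F^n.  Since [frob s] permutes the subspaces of F^n and preserves
    inclusions, replacing M by W = [frob s M] turns the two incidence
    conditions into the single condition L + phi L <= W.  The number of such W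
    depends only on d = dim (L :&: phi L), so the number of points is
    \sum_d T(l, d) g_(n-2l+d)^c(y), where T(l, d) ([card_position]) counts the
    l-dimensional L with that d; this is N_l^c(Q, y) as soon as
    T(l, d) = tau_(l,d)(Q, y).

    The numbers T(l, d) obey the recursion that defines tau.  For d = l they
    count the subspaces defined over the field with Q elements
    ([card_position_diag]).  For d < l, count the pairs (L, W) with dim L = l,
    dim W = 2l - d and L + phi L <= W.  Summing over L, and then over W, for
    which the condition reads phi L <= W :&: phi W, gives [sum_g_position],
    from which T(l, d) can be isolated: L + phi L has dimension exactly 2l - d
    when dim (L :&: phi L) = d, so that W is then unique.

    Both kinds of Gaussian binomials come from one count, [card_stable]: the
    k-dimensional phi-stable subspaces of a phi-stable U number
    g_(dim U, k)(Q).  A phi-stable subspace has a basis of phi-fixed vectors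
    ([stable_basis]), so one can count free k-tuples of fixed vectors as over
    the field with Q elements.  Taking |F| for Q makes every subspace stable
    and gives the count of all subspaces.

    For the degree, tau_(l,d) with d < l and 2l - d <= n is monic in y of
    degree (l - d)(n - l + d) ([tau_monic_deg]), by the same recursion: all the
    terms have strictly smaller degree except the one with
    u = max(l, 2(2l - d) - n) in the first sum.  In N_l^c the leading term is
    the one with l - d = min(l, n - l - c). *)

(** * Gaussian binomials *)

Definition gauss_num (m k : nat) : {poly int} := \prod_(i < k) ('X^m - 'X^i).

(** Each factor 'X^(m+1) - 'X^(i+1) is 'X times the corresponding factor of
    the smaller product; this reduces the q-Pascal rule to a polynomial
    identity. *)
Lemma gauss_numSS m k :
  gauss_num m.+1 k.+1 = ('X^(m.+1) - 1) * 'X^k * gauss_num m k.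
Proof.
rewrite /gauss_num big_ord_recl expr0 -mulrA; congr (_ * _).
have -> : 'X^k = \prod_(i < k) 'X :> {poly int} by rewrite prodr_const card_ord.
rewrite -big_split; apply: eq_bigr => i _ /=.
by rewrite /bump add1n mulrBr -!exprS.
Qed.

(** The Gaussian binomials by the q-Pascal rule, which makes the exactness of
    the Euclidean division in [g] provable by induction. *)
Fixpoint gauss (m k : nat) : {poly int} :=
  match m, k with
  | _, 0 => 1
  | 0, _.+1 => 0
  | m'.+1, k'.+1 => gauss m' k' + 'X^k * gauss m' k
  end.

Lemma gauss_small m k : (m < k)%N -> gauss m k = 0.
Proof.
by elim: m k => [|m IH] [|k] //= lt; rewrite !IH ?mulr0 ?addr0 //; lia.
Qed.

Lemma gauss_numE m k : gauss m k * gauss_num k k = gauss_num m k.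
Proof.
elim: m k => [|m IH] [|k] /=; rewrite ?mul1r //.
- by rewrite mul0r /gauss_num big_ord_recl subrr mul0r.
- by rewrite /gauss_num !big_ord0.
have numS : gauss_num m k.+1 = gauss_num m k * ('X^m - 'X^k).
  by rewrite /gauss_num big_ord_recr.
rewrite mulrDl -mulrA IH numS !gauss_numSS -IH !exprS; ring.
Qed.

Lemma gauss_num_monic m k : (k <= m)%N ->
  gauss_num m k \is monic /\ size (gauss_num m k) = (m * k).+1.
Proof.
elim: k => [|k IH] le_km.
  by rewrite /gauss_num big_ord0 size_poly1 muln0 monic1.
have [mon sz] := IH (ltnW le_km).
have szB : size ('X^m - 'X^k : {poly int}) = m.+1.
  by rewrite size_polyDl ?size_polyN !size_polyXn.
have monB : ('X^m - 'X^k : {poly int}) \is monic.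
  by rewrite monicE lead_coefDl ?size_polyN ?size_polyXn // lead_coefXn.
have -> : gauss_num m k.+1 = gauss_num m k * ('X^m - 'X^k).
  by rewrite /gauss_num big_ord_recr.
rewrite size_monicM // -?size_poly_eq0 ?szB // monicMl // sz; split=> //; lia.
Qed.

Lemma g_gauss (m k : nat) : g m k = gauss m k.
Proof.
rewrite /g /= lez_nat; case: leqP => [le_km|/gauss_small->//].
rewrite -/(gauss_num m k) -/(gauss_num k k) -gauss_numE.
by rewrite Pdiv.IdomainMonic.mulpK // (gauss_num_monic (leqnn k)).1.
Qed.

Lemma g_out (m k : int) : ~~ (0 <= k <= m) -> g m k = 0.
Proof. by rewrite /g => /negbTE->. Qed.

Lemma g0 (m : nat) : g m 0%N = 1.
Proof. by rewrite g_gauss; case: m. Qed.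

Lemma gauss_monic m k : (k <= m)%N ->
  gauss m k \is monic /\ size (gauss m k) = (k * (m - k)).+1.
Proof.
move=> le_km; have [mon sz] := gauss_num_monic (leqnn k).
have [] := gauss_num_monic le_km; rewrite -gauss_numE monicMr // => mong.
rewrite size_monicM ?monic_neq0 // sz => szE; split=> //; nia.
Qed.

Lemma gnn (m : nat) : g m m = 1.
Proof.
by rewrite g_gauss; elim: m => //= m ->; rewrite gauss_small // mulr0 addr0.
Qed.

Lemma gauss_num_horner (m k : nat) (q : nat) : (0 < q)%N ->
  (k <= m)%N -> (gauss_num m k).[q%:Z] = (\prod_(i < k) (q ^ m - q ^ i))%N%:Z.
Proof.
move=> q0 le_km; rewrite /gauss_num horner_prod -[RHS]natz natr_prod.
apply: eq_bigr => i _; rewrite !hornerE ?hornerXn natrB ?natrX ?natz //.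
by rewrite leq_pexp2l //; have := ltn_ord i; lia.
Qed.

(** The form in which counts of tuples reach [g]: for q > 1 the denominator
    does not vanish at q and can be cancelled.  If m < k, the factor i = m
    makes the right-hand side zero. *)
Lemma card_eq_gauss (m k q a : nat) : (1 < q)%N ->
  (a * \prod_(i < k) (q ^ k - q ^ i) = \prod_(i < k) (q ^ m - q ^ i))%N ->
  a%:Z = (g m k).[q%:Z].
Proof.
move=> q1 eqa; have dpos : (0 < \prod_(i < k) (q ^ k - q ^ i))%N.
  by rewrite prodn_gt0 // => i; rewrite subn_gt0 ltn_exp2l.
rewrite g_gauss; have [le_km|lt_mk] := leqP k m; last first.
  rewrite gauss_small // horner0; apply/eqP; move: eqa.
  rewrite [RHS](bigD1 (Ordinal lt_mk)) //= subnn mul0n => /eqP.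
  by rewrite muln_eq0 -[_ == _ :> int]/(a == 0)%N (gtn_eqF dpos) orbF.
have /(congr1 (horner^~ q%:Z)) := gauss_numE m k.
rewrite hornerM !gauss_num_horner // -?eqa ?PoszM; try lia.
by move/mulIf => -> //; lia.
Qed.

(** * Degrees in y *)

Definition monic_deg (R : idomainType) (D : nat) (P : {poly R}) :=
  P \is monic /\ size P = D.+1.

Lemma monic_degM (R : idomainType) D E (P Q : {poly R}) :
  monic_deg D P -> monic_deg E Q -> monic_deg (D + E) (P * Q).
Proof.
case=> mP sP [mQ sQ]; split; first by rewrite monicMl.
by rewrite size_monicM ?monic_neq0 // sP sQ addSn addnS.
Qed.

Lemma monic_degDl (R : idomainType) D (P Q : {poly R}) :
  monic_deg D P -> (size Q <= D)%N -> monic_deg D (P + Q).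
Proof.
case=> mP sP sQ; have lt : (size Q < size P)%N by rewrite sP ltnS.
by split; rewrite ?size_polyDl // monicE lead_coefDl // -monicE.
Qed.

Lemma monic_deg_sum (R : idomainType) D (I : eqType) (s : seq I) (i0 : I)
    (E : I -> {poly R}) :
  uniq s -> i0 \in s -> monic_deg D (E i0) ->
  (forall i, i \in s -> i != i0 -> (size (E i) <= D)%N) ->
  monic_deg D (\sum_(i <- s) E i).
Proof.
move=> us i0s mE sE; rewrite (bigD1_seq i0) //=; apply: monic_degDl => //.
rewrite big_seq_cond; apply: leq_trans (size_sum _ _ _) _.
by apply/bigmax_leqP_seq => i _ /andP[is_ ne]; apply: sE.
Qed.

Lemma size_sum_nat (R : idomainType) D m n (E : nat -> {poly R}) :
  (forall i, (m <= i < n)%N -> (size (E i) <= D)%N) ->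
  (size (\sum_(m <= i < n) E i)%R <= D)%N.
Proof.
move=> sE; rewrite big_nat_cond; apply: leq_trans (size_sum _ _ _) _.
by apply/bigmax_leqP_seq => i _ /andP[im _]; apply: sE.
Qed.

Lemma in_y_g_monic_deg (m k : int) : 0 <= k <= m ->
  monic_deg (`|k| * (`|m| - `|k|))%N (in_y (g m k)).
Proof.
move=> /andP[]; case: k => // k _; case: m => // m le_km.
rewrite g_gauss !absz_nat; have [mon sz] := @gauss_monic m k ltac:(lia).
have injC : injective (@polyC int) := @polyC_inj int.
split; last by rewrite /in_y size_map_inj_poly.
by rewrite /in_y monicE lead_coef_map_inj // (monicP mon).
Qed.

Lemma in_y0 : in_y 0 = 0. Proof. exact: map_poly0. Qed.

Lemma tau_out n l d : (n < l)%N || (l < d)%N -> tau n l d = 0.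
Proof. by rewrite tauE => ->. Qed.

Lemma tau_diag n l : (l <= n)%N -> tau n l l = in_x (g n l).
Proof. by move=> le; rewrite tauE ltnn orbF ltnNge le eqxx. Qed.

Lemma size_tau_diag n l : (size (tau n l l) <= 1)%N.
Proof.
case: (leqP l n) => [le|lt]; first by rewrite tau_diag // size_polyC_leq1.
by rewrite tau_out ?lt // size_poly0.
Qed.

Lemma tau_recE n l d : (d < l <= n)%N ->
  tau n l d =
    \sum_(l <= u < (2 * l - d)%N.+1) tau n (2 * l - d)%N u * in_y (g u l)
    - \sum_(d.+1 <= t < l.+1)
           tau n l t * in_y (g (n%:Z - 2 * l%:Z + t%:Z) (t%:Z - d%:Z)).
Proof.
by move=> H; rewrite tauE ifF ?ifF //; lia.
Qed.

(** Matches the impossibility of dim (L + phi L) = 2l - d > n.  In the recursion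
    the first sum runs over [tau n (2 * l - d) u] with 2l - d > n, and every
    term of the second sum vanishes: either [tau n l t] does by induction on
    l - d, or 2l - t <= n and then g_(n-2l+t, t-d) has t - d > n - 2l + t. *)
Lemma tau_eq0 n l d : (d < l)%N -> (n < 2 * l - d)%N -> tau n l d = 0.
Proof.
have [k] := ubnP (l - d); elim: k d => // k IH d lek lt_dl lt_n.
have [le_ln|lt_nl] := leqP l n; last by rewrite tau_out // lt_nl.
rewrite tau_recE ?lt_dl // !big_nat !big1 ?subr0 //; last first.
  by move=> u _; rewrite tau_out ?mul0r // lt_n.
move=> t tP; have [le_tn|lt_tn] := leqP (2 * l - t) n.
  by rewrite g_out ?in_y0 ?mulr0 //; lia.
by rewrite IH ?mul0r //; lia.
Qed.

(** Write w = 2l - d.  The u-th term of the first sum is zero for u < 2w - n,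
    and for u = l + e with e >= 2w - n - l its degree falls short of
    (l - d)(n - l + d) by e (n - 2w + l + e).  This is zero only for e = 0 or
    u = 2w - n, and of these two only u = max(l, 2w - n) lies in the allowed
    range.  The t-th term of the second sum falls short by (t - d) t > 0. *)
Lemma tau_monic_deg n l d : (d < l)%N -> (2 * l - d <= n)%N ->
  monic_deg ((l - d) * (n - l + d))%N (tau n l d).
Proof.
have [k] := ubnP ((n - l) * n.+1 + (l - d))%N.
elim: k l d => // k IH l d lek lt_dl le_n.
rewrite tau_recE; last lia.
set w := (2 * l - d)%N in le_n *.
apply: monic_degDl; last first.
  rewrite size_polyN; apply: size_sum_nat => t tP.
  apply: leq_trans (size_polyMleq _ _) _.
  have [_ ->] := @in_y_g_monic_deg (n%:Z - 2 * l%:Z + t%:Z) (t%:Z - d%:Z)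
    ltac:(lia).
  have -> : absz (n%:Z - 2 * l%:Z + t%:Z) = (n + t - 2 * l)%N by lia.
  have -> : absz (t%:Z - d%:Z) = (t - d)%N by lia.
  have [Et|ne_tl] := eqVneq t l.
    rewrite Et; have := size_tau_diag n l; move: (size _) => z; nia.
  have [_ ->] := IH l t ltac:(nia) ltac:(lia) ltac:(lia).
  (* t = d + b, l = t + a and z = n - w free the arithmetic of subtractions. *)
  have [a [b [z [E1 [E2 E3]]]]] : exists a b z,
    l = (t + a)%N /\ t = (d + b)%N /\ n = (2 * l - d + z)%N.
    by exists (l - t)%N, (t - d)%N, (n - w)%N; lia.
  have -> : (l - t = a)%N by lia.
  have -> : (n - l + t = z + a + 2 * b + d)%N by lia.
  have -> : (t - d = b)%N by lia.
  have -> : (n + t - 2 * l - b = z)%N by lia.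
  have -> : (l - d = a + b)%N by lia.
  have -> : (n - l + d = z + a + b + d)%N by lia.
  nia.
have deg u : (maxn l (2 * w - n) <= u < w)%N ->
    monic_deg ((w - u) * (n - w + u) + l * (u - l))%N
      (tau n w u * in_y (g u l)).
  move=> uP; apply: monic_degM; first by apply: IH; nia.
  by have := @in_y_g_monic_deg u l; rewrite !absz_nat; apply; lia.
have degw : (size (tau n w w * in_y (g w l))%R <= (l * (l - d)).+1)%N.
  apply: leq_trans (size_polyMleq _ _) _.
  have [_ ->] := @in_y_g_monic_deg w l ltac:(lia).
  rewrite !absz_nat; have := size_tau_diag n w.
  have -> : (w - l = l - d)%N by lia.
  by move: (size _) => z; nia.
apply: (@monic_deg_sum _ _ _ _ (maxn l (2 * w - n))).
- exact: iota_uniq.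
- by rewrite mem_index_iota; lia.
- have [u_lt|] := ltnP (maxn l (2 * w - n)) w.
    have := deg _ (introT andP (conj (leqnn _) u_lt)).
    congr (monic_deg _ _); move: u_lt.
    have [le|lt] := leqP (2 * w - n) l; first by nia.
    have [z [a [E1 E2]]] : exists z a, n = (w + z)%N /\ l = (d + a)%N.
      by exists (n - w)%N, (l - d)%N; lia.
    have -> : (w - (2 * w - n) = z)%N by lia.
    have -> : (n - w + (2 * w - n) = w)%N by lia.
    have [f Ef] : exists f, a = (z + f)%N by exists (a - z)%N; lia.
    have -> : (2 * w - n - l = f)%N by lia.
    have -> : (l - d = a)%N by lia.
    have -> : (n - l + d = d + a + z)%N by lia.
    have -> : w = (d + 2 * a)%N by lia.
    by rewrite E2 Ef; lia.
  (* Here w = n, and the top term is the diagonal one, with g_(n,n)(x) = 1. *)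
  move=> le_w; have En : n = w by lia.
  have -> : maxn l (2 * w - n) = w by lia.
  rewrite tau_diag -?En // gnn /in_x polyC1 mul1r.
  have := @in_y_g_monic_deg n l; rewrite !absz_nat => /(_ ltac:(lia)).
  by congr (monic_deg _ _); nia.
move=> u; rewrite mem_index_iota => uP ne_u.
have [Eu|ne_uw] := eqVneq u w.
  by rewrite Eu; apply: leq_trans degw _; nia.
have [lt_u|le_u] := ltnP u (2 * w - n).
  by rewrite tau_eq0 ?mul0r ?size_poly0 //; lia.
have [_ ->] := deg u ltac:(lia).
have [a [z [e [E1 [E2 E3]]]]] :
    exists a z e, l = (d + a)%N /\ n = (w + z)%N /\ u = (l + e)%N.
  by exists (l - d)%N, (n - w)%N, (u - l)%N; lia.
have [f Ef] : exists f, (e + z = a + f)%N by exists (e + z - a)%N; lia.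
have -> : (w - u = a - e)%N by lia.
have -> : (n - w + u = z + d + a + e)%N by lia.
have -> : (u - l = e)%N by lia.
have -> : (l - d = a)%N by lia.
have -> : (n - l + d = d + a + z)%N by lia.
have [b Eb] : exists b, a = (e + b)%N by exists (a - e)%N; lia.
have -> : (a - e = b)%N by lia.
have Ez : z = (b + f)%N by lia.
(* e * f is the degree gap. *)
have : (0 < e * f)%N by rewrite muln_gt0; lia.
by rewrite E1 Eb Ez; lia.
Qed.

(** With a = l - d, the d-th term has degree a (n - c - a) + c (n - l - c) for
    a <= min(l, n - l - c), and the terms with larger a vanish.  The parabola
    a (n - c - a) increases strictly up to that minimum, because l and
    n - l - c add up to n - c, and takes there the value l (n - l - c).  In
    terms of d, the top index is max(0, 2l + c - n), written with truncated
    subtraction. *)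
Lemma N_monic_deg n l c : (0 < l)%N -> (0 < c)%N -> (l + c < n)%N ->
  monic_deg ((l + c) * (n - l - c))%N (N n l c).
Proof.
move=> l0 c0 ltn_.
have degg d : (2 * l + c <= n + d)%N ->
    monic_deg (c * (n + d - 2 * l - c))%N
      (in_y (g_codim (n%:Z - 2 * l%:Z + d%:Z) c%:Z)).
  move=> le; rewrite /g_codim.
  set m := _ + d%:Z; have := @in_y_g_monic_deg m (m - c%:Z) ltac:(lia).
  by congr (monic_deg _ _); rewrite mulnC; congr (_ * _)%N; lia.
apply: (@monic_deg_sum _ _ _ _ (2 * l + c - n)%N).
- exact: iota_uniq.
- by rewrite mem_index_iota; lia.
- have := monic_degM (@tau_monic_deg n l (2 * l + c - n) ltac:(lia) ltac:(lia))
    (degg (2 * l + c - n)%N ltac:(lia)).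
  congr (monic_deg _ _).
  have [le|lt] := leqP (2 * l + c) n.
    have [z Ez] : exists z, n = (2 * l + c + z)%N.
      by exists (n - (2 * l + c))%N; lia.
    have -> : (2 * l + c - n = 0)%N by lia.
    have -> : (n - l + 0 = l + c + z)%N by lia.
    have -> : (n + 0 - 2 * l - c = z)%N by lia.
    have -> : (n - l - c = l + z)%N by lia.
    rewrite subn0; nia.
  have -> : (n + (2 * l + c - n) - 2 * l - c = 0)%N by lia.
  have -> : (n - l + (2 * l + c - n) = l + c)%N by lia.
  have -> : (l - (2 * l + c - n) = n - l - c)%N by lia.
  by rewrite muln0 addn0 mulnC.
move=> d; rewrite mem_index_iota => dP ne_d.
have [lt_d|le_d] := ltnP (n + d) (2 * l + c).
  by rewrite /g_codim g_out ?in_y0 ?mulr0 ?size_poly0 //; lia.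
have [Ed|ne_dl] := eqVneq d l.
  apply: leq_trans (size_polyMleq _ _) _.
  have [_ ->] := degg d le_d; rewrite Ed.
  have := size_tau_diag n l; move: (size _) => z zle.
  have -> : (n + l - 2 * l - c = n - l - c)%N by lia.
  nia.
have [_ ->] :=
  monic_degM (@tau_monic_deg n l d ltac:(lia) ltac:(lia)) (degg d le_d).
have [a [b [Ea Eb]]] : exists a b, l = (d + a)%N /\ (n + d = 2 * l + c + b)%N.
  by exists (l - d)%N, (n + d - (2 * l + c))%N; lia.
have -> : (l - d = a)%N by lia.
have -> : (n + d - 2 * l - c = b)%N by lia.
have -> : (n - l + d = l + c + b)%N by lia.
have -> : (n - l - c = a + b)%N by lia.
have d0 : (0 < d)%N by lia.
have b0 : (0 < b)%N by lia.
nia.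
Qed.

(** * The Frobenius twist of a subspace *)

(** The exponent condition is a phantom argument, so that the ring morphism
    structure can be attached to the function. *)
Definition pow_morph (F : finFieldType) (q : nat) (qP : [pchar F].-nat q)
  (x : F) : F := x ^+ q.

Section PowerMorphism.
Variables (F : finFieldType) (q : nat) (qP : [pchar F].-nat q).

Lemma pow_morph_is_zmod : zmod_morphism (pow_morph qP).
Proof.
move=> x y; have q0 : (0 < q)%N by case/andP: qP.
have D (a b : F) : (a + b) ^+ q = a ^+ q + b ^+ q by apply: exprDn_pchar.
rewrite /pow_morph D; congr (_ + _).
by apply/eqP; rewrite -addr_eq0 -D addNr expr0n gtn_eqF.
Qed.

Lemma pow_morph_is_monoid : monoid_morphism (pow_morph qP).
Proof. by split=> [|x y]; rewrite /pow_morph ?expr1n ?exprMn. Qed.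

HB.instance Definition _ :=
  GRing.isZmodMorphism.Build F F (pow_morph qP) pow_morph_is_zmod.
HB.instance Definition _ :=
  GRing.isMonoidMorphism.Build F F (pow_morph qP) pow_morph_is_monoid.
End PowerMorphism.

Section FrobeniusPower.
Variables (F : finFieldType) (n : nat).
Local Notation V := 'rV[F]_n.
Implicit Types (L M U W : {vspace V}) (v w : V).

Definition vfrob (q : nat) (v : V) : V := map_mx (fun t => t ^+ q) v.

Lemma memv_zeros (a : 'cV[F]_n) v : (v \in zeros a) = (v *m a == 0).
Proof. by rewrite memv_ker lfunE. Qed.

(** A subspace is the intersection of the hyperplanes containing it: the
    coordinates of v - projv L v are linear forms that vanish on L and, if all
    of them vanish at v, then v = projv L v. *)
Lemma zeros_separate L v :
  (forall a : 'cV[F]_n, (L <= zeros a)%VS -> v *m a = 0) -> v \in L.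
Proof.
move=> Hv; pose f : 'End(V) := (\1 - projv L)%VF; pose A := lin1_mx f.
have fE u : u *m A = u - projv L u.
  by rewrite mul_rV_lin1 /= add_lfunE opp_lfunE id_lfunE.
have vA0 : v *m A = 0.
  have colE u j : u *m col j A = col j (u *m A) by rewrite !colEsub mulmx_colsub.
  apply/rowP=> j; have /colP/(_ 0) : v *m col j A = 0; last first.
    by rewrite colE !mxE.
  apply: Hv; apply/subvP=> u uL; rewrite memv_zeros colE fE projv_id // subrr.
  by apply/eqP/colP=> i; rewrite !mxE.
by move/eqP: vA0; rewrite fE subr_eq0 => /eqP->; apply: memv_proj.
Qed.

Section Power.
Variables (q : nat) (qP : [pchar F].-nat q).

Lemma vfrobE v : vfrob q v = map_mx (pow_morph qP) v. Proof. by []. Qed.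

Lemma vfrob_inj : injective (vfrob q).
Proof. by move=> v w; rewrite !vfrobE => /map_mx_inj. Qed.

Lemma vfrob_surj v : exists w, vfrob q w = v.
Proof. by exists (invF vfrob_inj v); rewrite f_invF. Qed.

(** Characterizes [frob q L], as [vfrob q] is bijective. *)
Lemma memv_frob L v : (vfrob q v \in frob q L) = (v \in L).
Proof.
have zE (a : 'cV[F]_n) :
    (vfrob q v \in zeros (map_mx (fun t => t ^+ q) a)) = (v \in zeros a).
  rewrite !memv_zeros vfrobE -[map_mx _ a]/(map_mx (pow_morph qP) a).
  by rewrite -map_mxM map_mx_eq0.
rewrite memvE; apply/subv_bigcapP/idP => [H | vL a /subvP/(_ v vL)].
  by apply: zeros_separate => a /H; rewrite -memvE zE memv_zeros => /eqP.
by rewrite -memvE zE.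
Qed.

Lemma frob_sub L M : (frob q L <= frob q M)%VS = (L <= M)%VS.
Proof.
apply/subvP/subvP => sLM v; last first.
  by have [w <-] := vfrob_surj v; rewrite !memv_frob; apply: sLM.
by move=> vL; rewrite -memv_frob sLM // memv_frob.
Qed.

Lemma frob_inj : injective (fun L => frob q L).
Proof.
by move=> L M /eqP; rewrite eqEsubv !frob_sub -eqEsubv => /eqP.
Qed.

Lemma dim_frob L : \dim (frob q L) = \dim L.
Proof.
have := @card_imset _ _ _ (mem L) vfrob_inj.
have -> : [set vfrob q v | v in L] = [set v in frob q L].
  apply/setP=> v; rewrite inE; have [w <-] := vfrob_surj v.
  by rewrite memv_frob (mem_imset _ _ vfrob_inj).
rewrite cardsE !card_vspace => /eqP.
by rewrite eqn_exp2l ?finNzRing_gt1 // => /eqP.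
Qed.
End Power.

Lemma frob_comp q q' L : [pchar F].-nat q -> [pchar F].-nat q' ->
  frob (q * q') L = frob q (frob q' L).
Proof.
move=> qP q'P; have qq'P : [pchar F].-nat (q * q')%N by rewrite pnatM qP.
apply/vspaceP=> v; have [w <-] := vfrob_surj qq'P v; rewrite memv_frob //.
have -> : vfrob (q * q') w = vfrob q (vfrob q' w).
  by apply/matrixP=> i j; rewrite !mxE mulnC exprM.
by rewrite !memv_frob.
Qed.
End FrobeniusPower.

(** * Counting Frobenius-stable subspaces *)

(** 'X^Q - 'X divides 'X^|F| - 'X, which is the product of the 'X - a over F;
    so it has Q distinct roots in F. *)
Lemma card_fixed (F : finFieldType) (Q nu : nat) : (1 < Q)%N ->
  #|F| = (Q ^ nu)%N -> #|[pred a : F | a ^+ Q == a]| = Q.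
Proof.
move=> Q1 cF; pose p : {poly F} := 'X^Q - 'X.
have sp : size p = Q.+1.
  by rewrite size_polyDl ?size_polyXn ?size_polyN ?size_polyX.
have dvd k : p %| 'X^(Q ^ k) - 'X.
  elim: k => [|k IH]; first by rewrite expn0 expr1 subrr dvdp0.
  rewrite -[_ - _](subrKA 'X^Q) dvdp_add // expnSr exprM subrXX.
  exact: dvdp_mulr.
have := dvd nu; rewrite -cF finField_genPoly -big_enum => /dvdp_prod_XsubC[m].
set s := mask m _ => eqp_s.
have us : uniq s by rewrite mask_uniq // enum_uniq.
have rootE a : (a ^+ Q == a) = (a \in s).
  rewrite -(map_id s) -root_prod_XsubC big_map -(eqp_root eqp_s).
  by rewrite rootE !hornerE ?hornerXn subr_eq0.
rewrite (eq_card (B := mem s)) => [|a]; last by rewrite inE rootE.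
rewrite (card_uniqP us); apply/eqP; rewrite -eqSS -sp (eqp_size eqp_s).
by rewrite size_prod_XsubC.
Qed.

Section Counting.
Variables (F : finFieldType) (n : nat).
Local Notation V := 'rV[F]_n.
Implicit Types (L M U W : {vspace V}) (v w : V).
Variables (Q nu : nat).
Hypotheses (QP : [pchar F].-nat Q) (Q1 : (1 < Q)%N) (cF : #|F| = (Q ^ nu)%N).

Local Notation fixed := [pred v : V | vfrob Q v == v].

Lemma vfrob_sum k (a : 'I_k -> F) (X : k.-tuple V) : all fixed X ->
  vfrob Q (\sum_i a i *: X`_i) = \sum_i (a i) ^+ Q *: X`_i.
Proof.
move=> /allP fX; rewrite (vfrobE QP) raddf_sum; apply: eq_bigr => i _ /=.
rewrite map_mxZ; congr (_ *: _); apply/eqP.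
by have /= := fX X`_i; rewrite mem_nth ?size_tuple // => ->.
Qed.

(** A combination of free fixed vectors is fixed exactly when its coefficients
    are, and there are Q fixed scalars. *)
Lemma card_fixed_span k (X : k.-tuple V) : free X -> all fixed X ->
  #|[pred v | (v \in <<X>>%VS) && fixed v]| = (Q ^ k)%N.
Proof.
move=> freeX fX; pose K := [pred a : F | a ^+ Q == a].
pose f (c : {ffun 'I_k -> F}) := \sum_i c i *: X`_i.
have injf : injective f.
  move=> c c' eq_f; apply/ffunP=> i.
  by rewrite -(coord_sum_free c i freeX) [\sum__ _]eq_f coord_sum_free.
have -> : (Q ^ k = #|(ffun_on K : simpl_pred {ffun 'I_k -> F})|)%N.
  by rewrite card_ffun_on (card_fixed Q1 cF) card_ord.
rewrite -(card_image injf); apply: eq_card => v; rewrite !inE.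
apply/andP/imageP => [[vX /eqP fv] | [c /ffun_onP cK ->]].
  exists [ffun i => coord X i v]; last first.
    by rewrite {1}(coord_span vX); apply: eq_bigr => i _; rewrite ffunE.
  apply/ffun_onP=> i; rewrite ffunE inE -{2}fv [in vfrob _ _](coord_span vX).
  by rewrite vfrob_sum // coord_sum_free.
split.
  by apply: memv_suml => i _; rewrite memvZ // memv_span ?mem_nth ?size_tuple.
rewrite vfrob_sum //; apply/eqP/eq_bigr => i _.
by have := cK i; rewrite inE => /eqP->.
Qed.

(** Galois descent.  Take the matrix A of a basis of U and an invertible
    maximal minor C of it.  The rows of A0 = C^-1 A form the only basis of U
    whose minor in these columns is the identity; the twist of A0 has the same
    property, hence equals A0. *)
Lemma stable_basis U : frob Q U = U ->
  exists2 X : (\dim U).-tuple V, basis_of U X & all fixed X.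
Proof.
move=> stU; set k := \dim U; pose B := vbasis U.
pose A : 'M_(k, n) := \matrix_i B`_i.
have rowA i : row i A = B`_i by rewrite rowK.
have memA v : v \in U -> exists c, v = c *m A.
  move=> vU; exists (\row_i coord B i v); rewrite mulmx_sum_row.
  rewrite {1}(coord_vbasis vU); apply: eq_bigr => i _.
  by rewrite mxE rowA.
have Amem (c : 'rV_k) : c *m A \in U.
  rewrite mulmx_sum_row; apply: memv_suml => i _.
  by rewrite memvZ // rowA vbasis_mem // mem_nth ?size_tuple.
have freeA (c : 'rV_k) : c *m A = 0 -> c = 0.
  rewrite mulmx_sum_row => c0; apply/rowP=> i; rewrite mxE.
  have /freeP fB := basis_free (vbasisP U).
  apply: (fB (fun i => c 0 i)); rewrite -[RHS]c0.
  by apply: eq_bigr => j _; rewrite rowA.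
have fullAT : row_full A^T.
  rewrite /row_full mxrank_tr -/(row_free A) -kermx_eq0.
  by apply/rowV0P=> c /sub_kermxP; apply: freeA.
pose f := fullrankfun fullAT.
pose C := colsub f A.
have unitC : C \in unitmx.
  rewrite -unitmx_tr; suff -> : C^T = rowsub f A^T by apply: fullrowsub_unit.
  by apply/matrixP=> i j; rewrite !mxE.
pose A0 := invmx C *m A.
have A0C : colsub f A0 = 1%:M by rewrite /A0 -mulmx_colsub mulVmx.
have A0f : map_mx (pow_morph QP) A0 = A0.
  have [D ED] : exists D, map_mx (pow_morph QP) A0 = D *m A0.
    have rows i : exists c, row i (map_mx (pow_morph QP) A0) = c *m A0.
      have : row i (map_mx (pow_morph QP) A0) \in U.
        rewrite -stU -map_row -vfrobE memv_frob // -[X in X \in _]mul1mx.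
        by rewrite row_mul mul1mx.
      by case/memA=> c ->; exists (c *m C); rewrite mulmxA mulmxK.
    have [d Ed] := fin_all_exists rows; exists (\matrix_i d i).
    by apply/row_matrixP=> i; rewrite row_mul rowK Ed.
  have /(congr1 (colsub f)) := ED.
  rewrite -map_mxsub A0C map_mx1 -mulmx_colsub A0C mulmx1 => /esym D1.
  by rewrite ED D1 mul1mx.
exists [tuple row i A0 | i < k].
  rewrite basisEfree size_tuple leqnn andbT; apply/andP; split.
    apply/freeP=> c c0 i.
    have : (\row_j c j) *m A0 = 0.
      rewrite mulmx_sum_row -[RHS]c0; apply: eq_bigr => j _.
      by rewrite mxE -tnth_nth tnth_mktuple.
    rewrite mulmxA => /freeA/(canRL (mulmxKV unitC)).
    by rewrite mul0mx => /rowP/(_ i); rewrite !mxE.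
  by apply/span_subvP=> _ /mapP[i _ ->]; rewrite row_mul.
apply/allP=> _ /mapP[i _ ->] /=.
by rewrite (vfrobE QP) map_row A0f.
Qed.

Lemma card_fixed_stable U : frob Q U = U ->
  #|[pred v | (v \in U) && fixed v]| = (Q ^ \dim U)%N.
Proof.
case/stable_basis=> X bX fX; rewrite -(card_fixed_span (basis_free bX) fX).
by apply: eq_card => v; rewrite !inE (span_basis bX).
Qed.

Definition fixed_free U k : {set k.-tuple V} :=
  [set X : k.-tuple V | free X && all [pred v | (v \in U) && fixed v] X].

(** The twist of the span contains the fixed generators and has the same
    dimension. *)
Lemma span_stable k (X : k.-tuple V) : all fixed X -> frob Q <<X>>%VS = <<X>>%VS.
Proof.
move=> fX; apply/esym/eqP; rewrite eqEdim (dim_frob QP) leqnn andbT.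
apply/span_subvP=> v vX; move/allP/(_ v vX)/eqP: fX => <-.
by rewrite memv_frob // memv_span.
Qed.

(** A free k-tuple extends by any of the Q^(dim U) fixed vectors of U outside
    its span, which contains Q^k of them. *)
Lemma card_fixed_free U k : frob Q U = U ->
  #|fixed_free U k| = (\prod_(i < k) (Q ^ \dim U - Q ^ i))%N.
Proof.
move=> stU; elim: k => [|k IH].
  rewrite big_ord0; apply/eqP/cards1P; exists [tuple].
  by apply/setP=> X; rewrite !inE tuple0 eqxx /= nil_free.
rewrite big_ord_recr /= -IH.
pose cons2 (p : k.-tuple V * V) := [tuple of p.2 :: p.1].
have inj : injective cons2 by case=> X v [Y w] [-> /val_inj->].
pose ext X v := [&& v \in U, fixed v & v \notin <<X : k.-tuple V>>%VS].
have -> : fixed_free U k.+1 =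
    [set cons2 p | p in [pred p | (p.1 \in fixed_free U k) && ext p.1 p.2]].
  apply/setP=> X; case/tupleP: X => v X.
  rewrite -[in RHS]/(cons2 (X, v)) (mem_imset _ _ inj).
  rewrite !inE /= free_cons /ext /=.
  by case: (v \in U) (_ == v) (v \in _) (free X) (all _ _) => [] [] [] [] [].
rewrite (card_imset _ inj) -sum1_card.
rewrite -(pair_big_dep (mem (fixed_free U k)) ext (fun _ _ => 1%N)) /=.
rewrite -sum_nat_const; apply: eq_bigr => X; rewrite inE => /andP[frX aX].
have fX : all fixed X by apply: sub_all aX => v /andP[].
rewrite sum1_card -(card_fixed_stable stU) -(card_fixed_span frX fX).
rewrite -[X in (X - _)%N]cardsE -[X in (_ - X)%N]cardsE -cardsDS.
  apply: eq_card => v; rewrite !inE unfold_in /ext /=.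
  by case: (v \in U); case: (vfrob Q v == v); case: (v \in <<X>>%VS).
apply/subsetP=> v; rewrite !inE => /andP[vX ->]; rewrite andbT.
have /subvP : (<<X>> <= U)%VS; last exact.
by apply/span_subvP=> w wX; move/allP/(_ w wX)/andP: aX => [].
Qed.

(** Sort the free k-tuples of fixed vectors of U by their span. *)
Lemma card_stable_mul U k : frob Q U = U ->
  (#|[set W : {vspace V} | [&& \dim W == k, (W <= U)%VS & frob Q W == W]]|
    * \prod_(i < k) (Q ^ k - Q ^ i) = \prod_(i < k) (Q ^ \dim U - Q ^ i))%N.
Proof.
move=> stU; rewrite -(card_fixed_free k stU) -[RHS]sum1_card.
set S := [set W | _].
rewrite (partition_big (fun X : k.-tuple V => <<X>>%VS) (mem S)) /=; last first.
  move=> X; rewrite !inE => /andP[frX aX].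
  rewrite span_stable; last first.
    by apply: sub_all aX => v /andP[].
  rewrite (eqP frX) size_tuple !eqxx andbT.
  by apply/span_subvP=> v vX; move/allP/(_ v vX)/andP: aX => [].
rewrite -sum_nat_const; apply: eq_bigr => W.
rewrite inE => /and3P[/eqP dW sWU /eqP stW].
have := card_fixed_free k stW; rewrite dW => <-.
rewrite sum1_card; apply: eq_card => X.
rewrite !inE; apply/andP/andP=> [[frX aX] | []]; last first.
  rewrite inE => /andP[frX aX] /eqP<-; split=> //; apply/allP=> v vX /=.
  case/allP/(_ v vX)/andP: aX => _ fv.
  by apply/andP; split; first exact: memv_span.
split.
  rewrite inE frX; apply: sub_all aX => v /andP[vW fv].
  by apply/andP; split; first exact: (subvP sWU).
rewrite eqEdim dW (eqP frX) size_tuple leqnn andbT.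
by apply/span_subvP=> v vX; move/allP/(_ v vX)/andP: aX => [].
Qed.

Lemma card_stable U k : frob Q U = U ->
  #|[set W : {vspace V} | [&& \dim W == k, (W <= U)%VS & frob Q W == W]]|%:Z
  = (g (\dim U) k).[Q%:Z].
Proof. by move=> stU; apply/card_eq_gauss/card_stable_mul. Qed.
End Counting.

(** * Subspaces and superspaces over the full field *)

Section Grassmannians.
Variables (F : finFieldType) (n : nat).
Local Notation V := 'rV[F]_n.
Implicit Types (L M U W : {vspace V}).

Lemma card_pchar_nat : [pchar F].-nat #|F|.
Proof.
have [p _ pF] := finPcharP F.
rewrite (eq_pnat _ (pcharf_eq pF)) -cardsT.
exact: abelem_pgroup (fin_ring_pchar_abelem pF).
Qed.

Lemma frob_card L : frob #|F| L = L.
Proof.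
apply/vspaceP=> v.
rewrite -{1}[v](_ : vfrob #|F| v = v) ?memv_frob ?card_pchar_nat //.
by apply/matrixP=> i j; rewrite mxE expf_card.
Qed.

Lemma card_subspaces U k :
  #|[set W : {vspace V} | (\dim W == k) && (W <= U)%VS]|%:Z
  = (g (\dim U) k).[#|F|%:Z].
Proof.
rewrite -(card_stable card_pchar_nat (finNzRing_gt1 F) (esym (expn1 _)) k
           (frob_card U)).
by congr (Posz _); apply: eq_card => W; rewrite !inE frob_card eqxx andbT.
Qed.

Lemma dim_rowspace : \dim {: V} = n.
Proof. by rewrite dimvf dim_matrix; apply: mul1n. Qed.

(** W |-> W :&: U^C identifies the subspaces above U with those of a complement
    of U, by the modular law. *)
Lemma card_superspaces U k :
  #|[set W : {vspace V} | (\dim W == k) && (U <= W)%VS]|%:Z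
  = (g (n%:Z - (\dim U)%:Z) (k%:Z - (\dim U)%:Z)).[#|F|%:Z].
Proof.
have dimC : \dim (U^C) = (n - \dim U)%N.
  by rewrite dimv_compl dim_rowspace.
have le_Un : (\dim U <= n)%N.
  by have := dimvS (subvf U); rewrite dim_rowspace.
have [le_Uk|lt_kU] := leqP (\dim U) k; last first.
  rewrite g_out ?horner0; last lia.
  congr (Posz _); apply/eqP; rewrite cards_eq0; apply/eqP/setP=> W; rewrite !inE.
  by apply/negP=> /andP[/eqP dW /dimvS]; rewrite dW leqNgt lt_kU.
rewrite subzn // subzn // -dimC -card_subspaces; congr (Posz _).
have addK (W : {vspace V}) : (U <= W)%VS -> (U + (W :&: U^C))%VS = W.
  move=> sUW; rewrite capvC vspace_modl // addv_complf capfv //.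
have capK (W : {vspace V}) : (W <= U^C)%VS -> ((U + W) :&: U^C)%VS = W.
  by move=> sWC; rewrite addvC -vspace_modl // capv_compl addv0.
have dimD (W : {vspace V}) : (W <= U^C)%VS -> \dim (U + W) = (\dim U + \dim W)%N.
  move=> sWC; apply: dimv_disjoint_sum; apply/eqP; rewrite -subv0.
  by rewrite -(capv_compl U) capvS.
set A := [set W : {vspace V} | _ && (W <= U^C)%VS].
have injA : {in A &, injective (fun W => (U + W)%VS)}.
  move=> W W'; rewrite !inE => /andP[_ sW] /andP[_ sW'] eqUW.
  by rewrite -(capK W) // eqUW capK.
rewrite -(card_in_imset injA); apply: eq_card => W; rewrite !inE.
apply/andP/imsetP=> [[/eqP dW sUW] | [W' ]].
  exists (W :&: U^C)%VS; last by rewrite addK.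
  rewrite inE capvSr andbT; have := dimD _ (capvSr W _).
  by rewrite addK // dW => ->; rewrite addKn.
rewrite inE => /andP[/eqP dW' sW'] ->; rewrite addvSl dimD // dW'; split=> //.
by rewrite subnKC.
Qed.
End Grassmannians.

(** * Relative position of a subspace and its twist *)

Lemma eval_xyB P R x y : eval_xy (P - R) x y = eval_xy P x y - eval_xy R x y.
Proof. by rewrite /eval_xy !hornerE. Qed.

Lemma eval_xyM P R x y : eval_xy (P * R) x y = eval_xy P x y * eval_xy R x y.
Proof. by rewrite /eval_xy !hornerE. Qed.

Lemma eval_xy_sum (I : Type) (s : seq I) (A : pred I) E x y :
  eval_xy (\sum_(i <- s | A i) E i) x y = \sum_(i <- s | A i) eval_xy (E i) x y.
Proof. by rewrite /eval_xy !horner_sum. Qed.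

Lemma eval_xy0 x y : eval_xy 0 x y = 0.
Proof. by rewrite /eval_xy !horner0. Qed.

Lemma eval_xy_in_x f x y : eval_xy (in_x f) x y = f.[x].
Proof. by rewrite /eval_xy hornerC. Qed.

Lemma eval_xy_in_y f x y : eval_xy (in_y f) x y = f.[y].
Proof. by rewrite /eval_xy horner_map hornerC. Qed.

Lemma big_nat_drop m k (E : nat -> int) : (m <= k)%N ->
  (forall i, (i < m)%N -> E i = 0) ->
  \sum_(0 <= i < k) E i = \sum_(m <= i < k) E i.
Proof.
move=> le_mk E0; rewrite (@big_cat_nat _ _ _ m) //=.
by rewrite big_nat big1 ?add0r // => i /andP[_]; apply: E0.
Qed.

Section Position.
Variables (F : finFieldType) (n Q : nat).
Hypothesis QP : [pchar F].-nat Q.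
Local Notation V := 'rV[F]_n.
Implicit Types (L M U W : {vspace V}).
Local Notation y := (#|F|%:Z).

Definition card_position (l d : nat) : nat :=
  #|[set L : {vspace V} | (\dim L == l) && (\dim (L :&: frob Q L) == d)]|.

Lemma sum_by_position l (f : nat -> int) :
  \sum_(L : {vspace V} | \dim L == l) f (\dim (L :&: frob Q L))
  = \sum_(0 <= t < l.+1) (card_position l t)%:Z * f t.
Proof.
rewrite big_mkord.
rewrite (partition_big (fun L => inord (\dim (L :&: frob Q L)) : 'I_l.+1)
           xpredT) //=.
apply: eq_bigr => t _; rewrite -natz mulr_natl -sumr_const.
have posP L : \dim L = l -> (inord (\dim (L :&: frob Q L)) == t) =
    (\dim (L :&: frob Q L) == t).
  move=> dL; rewrite -val_eqE /= inordK // ltnS -dL.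
  exact: dimvS (capvSl _ _).
apply: eq_big => [L | L /andP[/eqP dL]]; last by rewrite posP // => /eqP->.
by rewrite inE; case: eqP => //= dL; rewrite posP.
Qed.

Lemma dim_add_frob L :
  (\dim (L + frob Q L))%:Z = 2 * (\dim L)%:Z - (\dim (L :&: frob Q L))%:Z.
Proof. by have := dimv_sum_cap L (frob Q L); rewrite (dim_frob QP); lia. Qed.

Lemma card_above_both L k :
  #|[set W : {vspace V} | (\dim W == k) && (L + frob Q L <= W)%VS]|%:Z =
  (g (n%:Z - 2 * (\dim L)%:Z + (\dim (L :&: frob Q L))%:Z)
     (k%:Z - 2 * (\dim L)%:Z + (\dim (L :&: frob Q L))%:Z)).[y].
Proof.
by rewrite card_superspaces dim_add_frob !opprB !addrA; do 2 f_equal; lia.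
Qed.

(** Applying phi to L turns L <= W, phi L <= W into phi L <= phi W, phi L <= W. *)
Lemma card_below_both W k :
  #|[set L : {vspace V} | (\dim L == k) && (L + frob Q L <= W)%VS]|%:Z =
  (g (\dim (W :&: frob Q W)) k).[y].
Proof.
rewrite -card_subspaces; congr (Posz _).
rewrite -(card_imset _ (frob_inj QP)); apply: eq_card => L'; rewrite !inE.
have [L ->] : exists L, L' = frob Q L.
  by exists (invF (@frob_inj _ n _ QP) L'); rewrite f_invF.
rewrite (mem_imset _ _ (frob_inj QP)) inE (dim_frob QP) subv_add subv_cap.
by rewrite (frob_sub QP); congr (_ && _); apply: andbC.
Qed.

(** Double count of the pairs (L, W) with dim L = l, dim W = k and
    L + phi L <= W. *)
Lemma sum_g_position l k :
  \sum_(0 <= t < l.+1) (card_position l t)%:Z *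
     (g (n%:Z - 2 * l%:Z + t%:Z) (k%:Z - 2 * l%:Z + t%:Z)).[y] =
  \sum_(0 <= u < k.+1) (card_position k u)%:Z * (g u l).[y].
Proof.
rewrite -(sum_by_position l (fun t =>
  (g (n%:Z - 2 * l%:Z + t%:Z) (k%:Z - 2 * l%:Z + t%:Z)).[y])).
rewrite -(sum_by_position k (fun u => (g u l).[y])).
under eq_bigr => L /eqP dL do
  rewrite -{1 2}dL -card_above_both -sum1_card -natz natr_sum.
under [RHS]eq_bigr => W _ do rewrite -card_below_both -sum1_card -natz natr_sum.
rewrite (exchange_big_dep (fun W => \dim W == k)) /=; last first.
  by move=> L W _; rewrite inE => /andP[].
apply: eq_bigr => W dW; apply: eq_bigl => L.
by rewrite !inE dW.
Qed.

Lemma card_position_eq0 l d : (d < l)%N -> (n < 2 * l - d)%N ->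
  card_position l d = 0%N.
Proof.
move=> lt_dl lt_n; apply/eqP; rewrite cards_eq0; apply/eqP/setP=> L.
rewrite !inE; apply/negP=> /andP[/eqP dL /eqP dI].
have := dimvS (subvf (L + frob Q L)); rewrite dim_rowspace.
by have := dim_add_frob L; rewrite dL dI; lia.
Qed.

Variable nu : nat.
Hypotheses (Q1 : (1 < Q)%N) (cF : #|F| = (Q ^ nu)%N).

(** d = l forces phi L = L. *)
Lemma card_position_diag l : (card_position l l)%:Z = (g n l).[Q%:Z].
Proof.
have stV : frob Q {: V} = fullv.
  by apply/eqP; rewrite eqEdim subvf (dim_frob QP) leqnn.
have := card_stable QP Q1 cF l stV; rewrite dim_rowspace => <-; congr (Posz _).
apply: eq_card => L; rewrite !inE subvf /=; case: eqP => //= <-.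
apply/eqP/eqP=> [dI | ->]; last by rewrite capvv.
have /eqP IL : (L :&: frob Q L)%VS == L by rewrite eqEdim capvSl dI leqnn.
by apply/esym/eqP; rewrite eqEdim (dim_frob QP) leqnn andbT; apply/capv_idPl.
Qed.

(** The induction follows the order in which tau is defined.  If 2l - d > n,
    both sides vanish; otherwise the coefficient of T(l, d) in
    [sum_g_position], for k = 2l - d, is g_(n-2l+d, 0) = 1. *)
Lemma card_position_tau l d : (card_position l d)%:Z = eval_xy (tau n l d) Q%:Z y.
Proof.
have [k] := ubnP ((n - l) * n.+1 + (l - d))%N.
elim: k l d => // k IH l d lek.
have [out|] := boolP ((n < l) || (l < d))%N.
  rewrite tau_out // eval_xy0; congr (Posz _); apply/eqP.
  rewrite cards_eq0; apply/eqP/setP=> L; rewrite !inE; apply/negP.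
  move=> /andP[/eqP dL /eqP dI]; have := dimvS (subvf L); rewrite dim_rowspace.
  by have := dimvS (capvSl L (frob Q L)); rewrite dL dI; lia.
rewrite negb_or -!leqNgt => /andP[le_ln le_dl].
have [->|ne_dl] := eqVneq d l.
  by rewrite tau_diag // eval_xy_in_x card_position_diag.
have lt_dl : (d < l)%N by lia.
have [le_n|lt_n] := leqP (2 * l - d) n; last first.
  by rewrite tau_eq0 // card_position_eq0 // eval_xy0.
rewrite tau_recE ?lt_dl // eval_xyB !eval_xy_sum; apply/(canRL (addrK _)).
have := sum_g_position l (2 * l - d).
rewrite (@big_nat_drop d); [|lia|]; last first.
  by move=> t lt_td; rewrite g_out ?horner0 ?mulr0 //; lia.
rewrite (@big_nat_drop l); [|lia|]; last first.
  by move=> u lt_ul; rewrite g_out ?horner0 ?mulr0 //; lia.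
rewrite big_ltn; last lia.
have -> : n%:Z - 2 * l%:Z + d%:Z = (n + d - 2 * l)%N%:Z by lia.
have -> : (2 * l - d)%N%:Z - 2 * l%:Z + d%:Z = 0%N%:Z by lia.
rewrite g0 hornerC mulr1 => E.
apply: etrans (etrans E _).
  congr (_ + _); apply: eq_big_nat => t tP.
  rewrite eval_xyM eval_xy_in_y -IH; last nia.
  by do 2 f_equal; f_equal; lia.
apply: eq_big_nat => u uP.
by rewrite eval_xyM eval_xy_in_y -IH //; nia.
Qed.

End Position.

(** * Points of the incidence variety *)

(** The bijection M |-> [frob s M]: applying [frob s] to the condition
    frob r L <= M gives frob (r * s) L <= frob s M. *)
Lemma card_incidence_fiber (F : finFieldType) (n r s c : nat)
    (L : {vspace 'rV[F]_n}) :
  [pchar F].-nat r -> [pchar F].-nat s -> (c <= n)%N ->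
  #|[set M | [&& M \in grass_codim F n c, (frob r L <= M)%VS
                & (L <= frob s M)%VS]]|
  = #|[set W : {vspace 'rV[F]_n} |
        (\dim W == n - c)%N && (L + frob (r * s) L <= W)%VS]|.
Proof.
move=> rP sP le_cn; rewrite -[LHS](card_imset _ (frob_inj sP)).
apply: eq_card => W; rewrite inE.
have [M ->] : exists M, W = frob s M.
  by exists (invF (@frob_inj _ n _ sP) W); rewrite f_invF.
rewrite (mem_imset _ _ (frob_inj sP)) !inE (dim_frob sP) subv_add.
rewrite mulnC (frob_comp _ sP rP) (frob_sub sP) [X in _ = _ && X]andbC.
congr (_ && _).
by apply/eqP/eqP; lia.
Qed.

Lemma card_frob_incidence (F : finFieldType) (n l c r s nu : nat) :
  [pchar F].-nat r -> [pchar F].-nat s -> (1 < r * s)%N ->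
  #|F| = ((r * s) ^ nu)%N -> (c <= n)%N ->
  #|frob_incidence F n r s l c|%:Z = eval_xy (N n l c) (r * s)%N%:Z #|F|%:Z.
Proof.
move=> rP sP rs1 cF le_cn.
have rsP : [pchar F].-nat (r * s)%N by rewrite pnatM rP.
have -> : #|frob_incidence F n r s l c| =
    (\sum_(L : {vspace 'rV[F]_n} | \dim L == l)
       #|[set M | [&& M \in grass_codim F n c, (frob r L <= M)%VS
                    & (L <= frob s M)%VS]]|)%N.
  under eq_bigr do rewrite -sum1_card.
  rewrite pair_big_dep /= -sum1_card; apply: eq_bigl => -[L M].
  by rewrite !inE /= -!andbA.
rewrite -natz natr_sum.
rewrite (eq_bigr (fun L =>
  (g_codim (n%:Z - 2 * l%:Z + (\dim (L :&: frob (r * s) L))%:Z)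
     c%:Z).[#|F|%:Z])); last first.
  move=> L /eqP dL; rewrite natz card_incidence_fiber // (card_above_both rsP) dL.
  by rewrite /g_codim; do 2 f_equal; lia.
rewrite (@sum_by_position F n (r * s) l
  (fun t => (g_codim (n%:Z - 2 * l%:Z + t%:Z) c%:Z).[#|F|%:Z])).
rewrite /N eval_xy_sum; apply: eq_bigr => d _.
by rewrite eval_xyM eval_xy_in_y (card_position_tau _ rsP rs1 cF).
Qed.

Theorem theorem2p2 (p n l c r s : nat)
  (p_prime : prime p) (n_ge3 : (3 <= n)%N)
  (l_gt0 : (0 < l)%N) (c_gt0 : (0 < c)%N) (lt_lc_n : (l + c < n)%N)
  (r_pow : exists a : nat, r = (p ^ a)%N)
  (s_pow : exists b : nat, s = (p ^ b)%N)
  (rs_gt1 : (1 < r)%N \/ (1 < s)%N) :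
  [/\ N n l c \is monic,
      size (N n l c) = ((l + c) * (n - l - c)).+1
    & forall (nu : nat) (F : finFieldType),
        (1 <= nu)%N -> #|F| = ((r * s) ^ nu)%N ->
        #|frob_incidence F n r s l c|%:Z
          = eval_xy (N n l c) (r * s)%N%:Z ((r * s) ^ nu)%N%:Z].
Proof.
have [monN szN] := N_monic_deg l_gt0 c_gt0 lt_lc_n.
split=> // nu F nu_gt0 cF.
have [[a Er] [b Es]] := (r_pow, s_pow).
have pF : p \in [pchar F].
  apply: (@card_finPcharP F p ((a + b) * nu)) p_prime.
  by rewrite cF Er Es -expnD expnM.
have powP e : [pchar F].-nat (p ^ e)%N.
  by rewrite (eq_pnat _ (pcharf_eq pF)) pnatX pnat_id.
rewrite -cF; apply: card_frob_incidence cF _; rewrite ?Er ?Es //; last lia.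
move: (prime_gt0 p_prime) rs_gt1; rewrite Er Es => p0.
have [ra sb] : (0 < p ^ a)%N /\ (0 < p ^ b)%N by rewrite !expn_gt0 p0.
by nia.
Qed.
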